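(* Let $\mathcal{H}=\{rrb,bbr,rby\}$. Then $h_2(n,\mathcal{H})=\lceil n/2\rceil+1$.
   Context: Here $n$ denotes the number of vertices of the complete graph $K_n$. Edge-colorings of $K_n$ use colors from $\{r,b,y\}$ (red, blue, yellow); they need not be proper, and not all colors need be used. A pattern is an edge-colored triangle, denoted by the multiset of the colors of its three edges; e.g. $rrb$ is the triangle with two red edges and one blue edge, $bbr$ has two blue edges and one red edge, and $rby$ is the rainbow triangle with one edge of each color. For a family $\mathcal{H}$ of patterns, $\operatorname{Forb}(n,\mathcal{H})$ is the set of all edge-colorings of $K_n$ with colors from $\{r,b,y\}$ in which no triangle has a coloring belonging to $\mathcal{H}$. For an edge-coloring $c$ of $K_n$, $h_2(c)$ is the maximum $k$ such that there is a set of $k$ vertices whose induced edges use at most two of the three colors. Finally, $h_2(n,\mathcal{H})=\min\{h_2(c): c\in\operatorname{Forb}(n,\mathcal{H})\}$.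
   Formalization: The formal theorem assumes n ≥ 2, because the formula fails for n = 0 and n = 1: K_1 has no edges, so h_2 = 1, whereas ⌈1/2⌉+1 = 2 (and for n = 0, h_2 = 0 rather than 1). *)

(* Defs.v *)
From HB Require Import structures.
From mathcomp Require Import all_boot.
Set Implicit Arguments.
Unset Strict Implicit.
Unset Printing Implicit Defensive.

Inductive color := red | blue | yellow.

Definition nat_of_color (x : color) : nat :=
  match x with red => 0 | blue => 1 | yellow => 2 end.
Definition color_of_nat (i : nat) : option color :=
  match i with 0 => Some red | 1 => Some blue | 2 => Some yellow | _ => None end.
Lemma nat_of_colorK : pcancel nat_of_color color_of_nat.
Proof. by case. Qed.
HB.instance Definition _ := Countable.copy color (pcan_type nat_of_colorK).

Lemma color_enumP : Finite.axiom [:: red; blue; yellow].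
Proof. by case. Qed.
HB.instance Definition _ := isFinite.Build color color_enumP.

Definition edge (n : nat) := {e : {set 'I_n} | #|e| == 2}.

Definition coloring (n : nat) := {ffun edge n -> color}.

(* A multiset of three colors is a triple, read up to perm_eq. *)
Definition pattern := 3.-tuple color.

(* The colors of the edges inside A, listed with multiplicity. *)
Definition colors_in (n : nat) (c : coloring n) (A : {set 'I_n}) : seq color :=
  [seq c e | e in [pred e : edge n | val e \subset A]].

Definition Forb (n : nat) (H : seq pattern) : {set coloring n} :=
  [set c : coloring n |
    [forall T : {set 'I_n}, (#|T| == 3) ==>
       ~~ has (fun p : pattern => perm_eq (colors_in c T) p) H]].

Definition h2_col (n : nat) (c : coloring n) : nat :=
  \max_(A : {set 'I_n} | size (undup (colors_in c A)) <= 2) #|A|.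

(* As h2_col c <= n always, the default n does not affect the minimum over a
   nonempty Forb n H; see h2_minP. *)
Definition h2 (n : nat) (H : seq pattern) : nat :=
  \big[minn/n]_(c in Forb n H) h2_col c.

Lemma h2_col_le (n : nat) (c : coloring n) : h2_col c <= n.
Proof.
by apply/bigmax_leqP => A _; apply: leq_trans (max_card _) _; rewrite card_ord.
Qed.

Lemma h2_minP (n : nat) (H : seq pattern) :
  Forb n H != set0 ->
  (exists2 c, c \in Forb n H & h2_col c = h2 n H)
  /\ (forall c, c \in Forb n H -> h2 n H <= h2_col c).
Proof.
case/set0Pn => c0 Fc0; case: (arg_minnP (@h2_col n) Fc0) => c Fc cmin.
have {}Fc : c \in Forb n H by exact: Fc.
suff E : h2 n H = h2_col c by split=> [|d Fd]; [exists c | rewrite E cmin].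
apply/eqP; rewrite eqn_leq /h2; apply/andP; split.
  have := mem_index_enum c; elim: (index_enum _) => // d s IHs.
  rewrite inE big_cons => /orP[/eqP <-|/IHs le_s]; first by rewrite Fc geq_minl.
  by case: ifP => // _; apply: leq_trans (geq_minr _ _) le_s.
apply: (big_ind (fun m => h2_col c <= m)) => [|x y cx cy|d Fd].
- exact: h2_col_le.
- by rewrite leq_min cx.
- exact: cmin.
Qed.

Definition rrb : pattern := [tuple red; red; blue].
Definition bbr : pattern := [tuple blue; blue; red].
Definition rby : pattern := [tuple red; blue; yellow].

(* Main.v *)
Require Import Defs.
From mathcomp Require Import all_boot.

(** A triangle with both a red and a blue edge always has a forbidden pattern,
    so no vertex meets both a red and a blue edge.  Hence the vertices meeting
    no blue edge and those meeting no red edge cover [K_n], and one of these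
    sets has at least [n/2] vertices; adding one more vertex to it creates no
    edge of the avoided color.  Conversely, split the vertices into two halves,
    one spanning a red clique and the other a blue one, with yellow in between:
    a set with at least two vertices in each half sees all three colors. *)

Lemma card_color : #|{: color}| = 3.
Proof. by rewrite cardE enumT unlock. Qed.

(** With only three colors in all, the size bound in [h2_col] becomes the avoidance of a single
    color. *)
Lemma size_undup_colors (s : seq color) :
  (size (undup s) <= 2) = [exists k, k \notin s].
Proof.
apply/idP/existsP => [le2 | [k ks]].
  apply/existsP; apply: contraLR le2 => /existsPn all_s.
  rewrite -ltnNge; apply: (@uniq_leq_size _ [:: red; blue; yellow]) => // k _.
  by rewrite mem_undup; apply/negPn/all_s.
rewrite -(card_uniqP (undup_uniq s)) -ltnS -card_color.
apply: proper_card; apply/properP; split; first exact/subsetP.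
by exists k; rewrite // mem_undup.
Qed.

Section Colorings.
Variable n : nat.
Implicit Types (c : coloring n) (A S T : {set 'I_n}) (e f : edge n) (k : color).

Lemma edge_card e : #|val e| = 2.
Proof. exact/eqP/(valP e). Qed.

Lemma mem_colors_in c A k :
  reflect (exists2 e : edge n, val e \subset A & c e = k) (k \in colors_in c A).
Proof.
by apply: (iffP imageP) => -[e eA eq_k]; exists e.
Qed.

Lemma edge_sub_exists A : 1 < #|A| -> exists e : edge n, val e \subset A.
Proof.
case/card_gt1P => x [y [xA yA xy]].
have e2 : #|[set x; y]| == 2 by rewrite cards2 xy.
by exists (Sub [set x; y] e2); rewrite SubK subUset !sub1set xA.
Qed.

Lemma size_colors_in c A : size (colors_in c A) = 'C(#|A|, 2).
Proof.
rewrite size_map -cardE -cards_draws -(card_imset _ val_inj).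
apply: eq_card => B; rewrite !inE; apply/imsetP/andP => [[e eA ->] | [BA B2]].
  by rewrite edge_card.
by exists (Sub B B2); rewrite ?SubK ?inE.
Qed.

(** The third color decides the pattern: red gives [rrb], blue gives [bbr], yellow gives [rby]. *)
Lemma perm_eq_forbidden (s : seq color) :
  size s = 3 -> red \in s -> blue \in s ->
  has (fun p : pattern => perm_eq s p) [:: rrb; bbr; rby].
Proof. by case: s => [|[] [|[] [|[] []]]]. Qed.

Lemma forbiddenP (s : seq color) :
  has (fun p : pattern => perm_eq s p) [:: rrb; bbr; rby] ->
  red \in s /\ blue \in s.
Proof. by case/or4P => // /perm_mem E; rewrite !E. Qed.

Lemma h2_col_ge c S k :
  2 <= n -> (forall e, c e = k -> [disjoint val e & S]) ->
  uphalf n <= #|S| -> uphalf n + 1 <= h2_col c.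
Proof.
move=> n2 kS leS.
have good A : k \notin colors_in c A -> #|A| <= h2_col c.
  move=> kA; apply: (@leq_bigmax_cond _ _ (fun A : {set 'I_n} => #|A|)).
  by rewrite size_undup_colors; apply/existsP; exists k.
(* If [S] is everything, no vertex can be added, but then color [k] never occurs and the whole
   vertex set counts; [uphalf n + 1 <= n] because [n >= 2]. *)
have [ST | /subsetPn [x _ xS]] := boolP ([set: 'I_n] \subset S).
  have: #|[set: 'I_n]| <= h2_col c.
    apply: good; apply/mem_colors_in => -[e _ /kS].
    rewrite disjoint_sym => /(disjointWl ST)/pred0P eT.
    have := edge_card e; suff -> : val e = set0 by rewrite cards0.
    by apply/setP => z; have := eT z; rewrite !inE.
  apply: leq_trans; rewrite cardsT card_ord addn1 uphalf_half.
  rewrite -[leqRHS]odd_double_half -addnS leq_add2l -addnn -addn1 leq_add2l.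
  by rewrite half_gt0.
apply: leq_trans (good (x |: S) _); first by rewrite cardsU1 xS addnC leq_add2l.
apply/mem_colors_in => -[e exS /kS eS].
(* An edge of color [k] inside [x |: S] misses [S], so only one vertex is left for its two ends. *)
have : val e \subset [set x].
  apply/subsetP => z ze; have := subsetP exS z ze; rewrite !inE.
  by rewrite (disjointFr eS ze) orbF.
by move/subset_leq_card; rewrite edge_card cards1.
Qed.

(** Edges of different colors are distinct, so if they meet, they share exactly one vertex and span
    a triangle containing both red and blue. *)
Lemma Forb_red_blue_disjoint c e f :
  c \in Forb n [:: rrb; bbr; rby] -> c e = red -> c f = blue ->
  [disjoint val e & val f].
Proof.
rewrite inE => /forallP Fc ce cf; apply: contraTT isT => meet_ef.
have I_gt0 : 0 < #|val e :&: val f| by rewrite card_gt0 setI_eq0.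
have I_lt2 : #|val e :&: val f| < 2.
  rewrite -[X in _ < X](edge_card e); apply: proper_card.
  rewrite properEneq subsetIl andbT; apply/eqP => /setIidPl sub_ef.
  suff Eef : e = f by rewrite Eef cf in ce.
  by apply/val_inj/eqP; rewrite eqEcard sub_ef !edge_card.
have T3 : #|val e :|: val f| = 3.
  rewrite cardsU !edge_card; have -> // : #|val e :&: val f| = 1.
  by apply/eqP; rewrite eqn_leq I_gt0 andbT.
have := Fc (val e :|: val f); rewrite T3 /= => /negP[].
apply: perm_eq_forbidden; first by rewrite size_colors_in T3.
  by apply/mem_colors_in; exists e; rewrite ?subsetUl.
by apply/mem_colors_in; exists f; rewrite ?subsetUr.
Qed.

Lemma Forb_h2_col_ge c :
  2 <= n -> c \in Forb n [:: rrb; bbr; rby] -> uphalf n + 1 <= h2_col c.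
Proof.
move=> n2 Fc.
pose avoid k := [set v | [forall e, (c e == k) ==> (v \notin val e)]].
have avoidP k e : c e = k -> [disjoint val e & avoid k].
  move=> ce; rewrite disjoint_sym disjoint_subset; apply/subsetP => v.
  by rewrite !inE => /forallP/(_ e); rewrite ce eqxx.
have cover : avoid red :|: avoid blue = setT.
  apply/setP => v; rewrite !inE; apply/norP => -[].
  case/forallPn => e; rewrite negb_imply negbK => /andP[/eqP ce ve].
  case/forallPn => f; rewrite negb_imply negbK => /andP[/eqP cf vf].
  by have := disjointFr (Forb_red_blue_disjoint c e f Fc ce cf) ve; rewrite vf.
have [|lt_red] := leqP (uphalf n) #|avoid red|.
  exact: h2_col_ge n2 (avoidP red).
apply: h2_col_ge n2 (avoidP blue) _.
have le_n : n <= #|avoid red| + #|avoid blue|.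
  by rewrite -cardsUI cover cardsT card_ord leq_addr.
rewrite leqNgt; apply/negP => lt_blue; move: le_n; apply/negP.
(* A size below [uphalf n] has its double below [n], so two such sizes add up to less than [n]. *)
rewrite -ltnNge -ltn_double doubleD -[ltnRHS]addnn -addSn.
by apply: leq_add; [|apply: ltnW]; rewrite ltnNge -leq_uphalf_double -ltnNge.
Qed.

Definition bipartite_coloring S : coloring n :=
  [ffun e : edge n => if val e \subset S then red
                      else if val e \subset ~: S then blue else yellow].

Lemma bipartite_coloring_red S e :
  (bipartite_coloring S e == red) = (val e \subset S).
Proof. by rewrite ffunE; case: ifP => // _; case: ifP. Qed.

Lemma bipartite_coloring_blue S e :
  (bipartite_coloring S e == blue) = (val e \subset ~: S).
Proof.
(* The test for red comes first but hides no blue edge: no edge lies in both [S] and its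
   complement. *)
rewrite ffunE; case: ifP => [eS|_]; last by case: ifP.
apply/esym/negP => eC.
have : val e \subset S :&: ~: S by rewrite subsetI eS.
by rewrite setICr => /subset_leq_card; rewrite edge_card cards0.
Qed.

(** Each forbidden pattern contains red and blue, but here a red and a blue edge are disjoint and
    need four vertices. *)
Lemma bipartite_coloring_Forb S :
  bipartite_coloring S \in Forb n [:: rrb; bbr; rby].
Proof.
rewrite inE; apply/forallP => T; apply/implyP => /eqP T3.
apply/negP => /forbiddenP [/mem_colors_in [e eT /eqP]].
rewrite bipartite_coloring_red => eS /mem_colors_in [f fT /eqP].
rewrite bipartite_coloring_blue => fS.
have ef0 : val e :&: val f = set0.
  by apply/eqP; rewrite -subset0 -(setICr S) setISS.
have : val e :|: val f \subset T by rewrite subUset eT.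
by move/subset_leq_card; rewrite T3 cardsU ef0 cards0 !edge_card.
Qed.

Lemma h2_col_bipartite_le S m :
  0 < m -> #|S| <= m -> #|~: S| <= m -> h2_col (bipartite_coloring S) <= m + 1.
Proof.
move=> m0 Sm Cm; apply/bigmax_leqP => A; apply: contraLR; rewrite -ltnNge => ltA.
rewrite size_undup_colors negb_exists; apply/forallP => k; rewrite negbK.
have part : #|A :&: S| + #|A :&: ~: S| = #|A| by rewrite -setDE cardsID.
(* Each side holds at most [m] of the more than [m + 1] vertices of [A], which leaves at least two
   for the other side. *)
have S2 : 1 < #|A :&: S|.
  rewrite ltnNge; apply/negP => le1; move: ltA; rewrite -part addnC ltnNge.
  by rewrite leq_add // (leq_trans (subset_leq_card (subsetIr _ _)) Cm).
have C2 : 1 < #|A :&: ~: S|.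
  rewrite ltnNge; apply/negP => le1; move: ltA; rewrite -part ltnNge.
  by rewrite leq_add // (leq_trans (subset_leq_card (subsetIr _ _)) Sm).
apply/mem_colors_in; case: k.
- have [e] := edge_sub_exists _ S2; rewrite subsetI => /andP[eA eS].
  by exists e => //; apply/eqP; rewrite bipartite_coloring_red.
- have [e] := edge_sub_exists _ C2; rewrite subsetI => /andP[eA eS].
  by exists e => //; apply/eqP; rewrite bipartite_coloring_blue.
(* For yellow, join a vertex of [A] in [S] to one outside [S]. *)
have /card_gt0P[x] := ltnW S2; rewrite inE => /andP[xA xS].
have /card_gt0P[y] := ltnW C2; rewrite !inE => /andP[yA yS].
have xy : #|[set x; y]| == 2.
  by rewrite cards2; case: (x =P y) => // Exy; rewrite -Exy xS in yS.
exists (Sub [set x; y] xy); first by rewrite SubK subUset !sub1set xA.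
by rewrite ffunE SubK !subUset !sub1set !inE xS (negPf yS).
Qed.

End Colorings.

Theorem lemma3p5 (n : nat) (hn : 2 <= n) :
  h2 n [:: rrb; bbr; rby] = uphalf n + 1.
Proof.
pose S := [set i : 'I_n | i < uphalf n].
have cardS : #|S| = uphalf n.
  rewrite -sum1dep_card (big_ord_narrow (F := fun _ => 1)) ?sum1_card ?card_ord //.
  by rewrite leq_uphalf_double -addnn leq_addr.
have cardC : #|~: S| = n./2.
  apply/eqP; rewrite -(eqn_add2l #|S|) cardsC card_ord cardS.
  by rewrite uphalf_half -addnA addnn odd_double_half.
have FS := bipartite_coloring_Forb n S.
(* The extremal coloring also shows that [Forb] is nonempty, so [h2] is a true minimum, attained by
   some [c]. *)
have [|[c Fc <-] h2_le] := @h2_minP n [:: rrb; bbr; rby].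
  by apply/set0Pn; exists (bipartite_coloring n S).
apply/eqP; rewrite eqn_leq Forb_h2_col_ge // andbT.
apply: leq_trans (h2_le _ FS) (h2_col_bipartite_le _ _ _ _ _ _).
- by rewrite uphalf_gt0 ltnW.
- by rewrite cardS.
- by rewrite cardC uphalf_half leq_addl.
Qed.
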